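(* Let $(Z,d)$ be a bounded metric space containing at least two points and let $(\mathcal{H}(Z),\rho)$ be the hyperbolic cone over $(Z,d)$. If $(\mathcal{H}(Z),\rho)$ is uniformly coarsely proper and $(Z,d)$ is a finite union of uniformly coarsely connected components, each containing at least two points, then $(\mathcal{H}(Z),\rho)$ is non-amenable.
   Context: Hyperbolic cone: for a bounded metric space $(Z,d)$ with at least two points and $D=\mathrm{diam}(Z)$, $\mathcal{H}(Z)=Z\times[0,\infty)$ with the metric $\rho((x,t),(y,s))=2\log\left(\frac{d(x,y)+\max\{e^{-t},e^{-s}\}D}{e^{-(s+t)/2}D}\right)$. Write $B(x,r)=\{y: d(x,y)<r\}$ for open balls in a metric space $(X,d)$. Uniformly coarsely proper: $(X,d)$ is uniformly coarsely proper if there exist $N\colon(0,\infty)\times(0,\infty)\to\mathbb{N}$ and $r_b>0$ such that for all $R>r>r_b$ every open ball of radius $R$ in $X$ can be covered by $N(R,r)$ open balls of radius $r$ in $X$. Quasi-lattice: a subset $\Gamma\subseteq X$ which is cobounded (there is $\mu>0$ with $d(x,\Gamma)<\mu$ for all $x\in X$) and uniformly locally finite (there is $N\colon(0,\infty)\to\mathbb{N}$ with $\#(\Gamma\cap B(x,r))\le N(r)$ for all $0<r<\infty$ and all $x\in X$). Non-amenable: a uniformly coarsely proper space $(X,d)$ is non-amenable if there exist a quasi-lattice $\Gamma\subseteq X$ and constants $C>0$, $r>0$ such that every finite subset $F\subseteq\Gamma$ satisfies $\#F\le C\,\#\partial_rF$, where $\partial_rF=\{x\in\Gamma: d(x,F)<r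 \text{ and } d(x,\Gamma\setminus F)<r\}$. Coarse connectedness: for $\varepsilon>0$, $(X,d)$ is $\varepsilon$-coarsely connected if for all $x,y\in X$ there is a finite sequence $x=x_0,\dots,x_n=y$ in $X$ with $d(x_i,x_{i+1})\le\varepsilon$ for all $0\le i\le n-1$. It is uniformly coarsely connected if it is $\varepsilon$-coarsely connected for all $\varepsilon>0$. A uniformly coarsely connected component of $(X,d)$ is a subset of the form $C(x,X)=\bigcup\{A: x\in A\subseteq X,\ A \text{ uniformly coarsely connected}\}$ with $x \in X$ (subsets carry the restricted metric). *)

(* Defs.v *)
From HB Require Import structures.
From mathcomp Require Import all_boot all_order all_algebra finmap.
From mathcomp Require Import all_classical all_reals.
From mathcomp Require Import ereal topology normedtype sequences exp.
From mathcomp Require Import ring lra.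

Set Implicit Arguments.
Unset Strict Implicit.
Unset Printing Implicit Defensive.

Import Order.TTheory GRing.Theory Num.Theory.

Local Open Scope classical_set_scope.
Local Open Scope ring_scope.

Section MetricNotions.
Context {R : realType}.
Implicit Type X : metricType R.

Definition bounded_space X : Prop :=
  exists M : R, forall x y : X, mdist x y <= M.

(* A real supremum, so meaningful only for bounded nonempty spaces. *)
Definition diam X : R :=
  sup [set d | exists x y : X, d = mdist x y].

Definition two_points (T : Type) (A : set T) : Prop :=
  exists x y : T, [/\ A x, A y & x <> y].

(* Extended-real valued, so that the distance to the empty set is +oo. *)
Definition dist_set X (x : X) (A : set X) : \bar R :=
  ereal_inf [set (mdist x a)%:E | a in A].

Definition uniformly_coarsely_proper X : Prop :=
  exists (N : R -> R -> nat) (rb : R), 0 < rb /\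
    forall R0 r : R, rb < r -> r < R0 ->
    forall x : X, exists c : 'I_(N R0 r) -> X,
      ball x R0 `<=` \bigcup_(i in [set: 'I_(N R0 r)]) ball (c i) r.

Definition cobounded X (G : set X) : Prop :=
  exists mu : R, 0 < mu /\ forall x : X, (dist_set x G < mu%:E)%E.

Definition uniformly_locally_finite X (G : set X) : Prop :=
  exists N : R -> nat, forall (r : R) (x : X), 0 < r ->
    (G `&` ball x r #<= `I_(N r))%card.

Definition quasi_lattice X (G : set X) : Prop :=
  cobounded G /\ uniformly_locally_finite G.

Definition boundary X (G : set X) (r : R) (F : set X) : set X :=
  [set x | [/\ G x, (dist_set x F < r%:E)%E
             & (dist_set x (G `\` F) < r%:E)%E]].

(* [fset_set] sends infinite sets to the empty one; this never happens below, *)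
(* by [finite_boundary].                                                       *)
Definition non_amenable X : Prop :=
  exists G : set X, quasi_lattice G /\
  exists C r : R, [/\ 0 < C, 0 < r &
    forall F : set X, finite_set F -> F `<=` G ->
      (#|` fset_set F|)%:R <= C * (#|` fset_set (boundary G r F)|)%:R].

Lemma finite_boundary X (G : set X) (r : R) (F : set X) :
  uniformly_locally_finite G -> 0 < r -> finite_set F ->
  finite_set (boundary G r F).
Proof.
move=> [N HN] r0 Ffin.
apply: (@sub_finite_set _ _ (\bigcup_(y in F) (G `&` ball y r))).
  move=> x [Gx xF _].
  move: xF => /ereal_inf_lt[_ [y Fy <-]]; rewrite lte_fin => xy.
  by exists y => //; split => //; rewrite ballEmdist/= metric_sym.
apply: bigcup_finite => // y Fy.
exact: card_le_finite (HN r y r0) (finite_II _).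
Qed.

Definition coarsely_connected X (e : R) (A : set X) : Prop :=
  forall x y : X, A x -> A y ->
  exists (n : nat) (u : nat -> X),
    [/\ u 0%N = x, u n = y, forall i, (i <= n)%N -> A (u i)
      & forall i, (i < n)%N -> mdist (u i) (u i.+1) <= e].

Definition uniformly_coarsely_connected X (A : set X) : Prop :=
  forall e : R, 0 < e -> coarsely_connected e A.

Definition ucc_component_of X (x : X) : set X :=
  \bigcup_(A in [set A : set X | A x /\ uniformly_coarsely_connected A]) A.

Definition ucc_component X (C : set X) : Prop :=
  exists x : X, C = ucc_component_of x.

End MetricNotions.

(* The two proof arguments make the distance below a metric. *)
Definition hyperbolic_cone (R : realType) (Z : metricType R)
  (Zb : bounded_space Z) (Z2 : two_points [set: Z]) : Type :=
  (Z * {nonneg R})%type.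

Section HyperbolicCone.
Context {R : realType} {Z : metricType R}.
Variables (Zb : bounded_space Z) (Z2 : two_points [set: Z]).

Local Notation H := (hyperbolic_cone Zb Z2).
Local Notation D := (diam Z).

HB.instance Definition _ := Choice.copy H (Z * {nonneg R})%type.

Definition cone_dist (p q : H) : R :=
  let: (x, t) := p in let: (y, s) := q in
  2 * ln ((mdist x y + Num.max (expR (- t%:num)) (expR (- s%:num)) * D)
          / (expR (- ((s%:num + t%:num) / 2)) * D)).

Let D_gt0 : 0 < D.
Proof.
have [x [y [_ _ /eqP xy]]] := Z2; have [M HM] := Zb.
apply: (@lt_le_trans _ _ (mdist x y)); first by rewrite mdist_gt0.
apply: ub_le_sup; last by exists x, y.
by exists M => _ [a [b ->]].
Qed.

Let num_gt0 (x y : Z) (t s : R) :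
  0 < mdist x y + Num.max (expR (- t)) (expR (- s)) * D.
Proof.
by rewrite ltr_wpDl ?mdist_ge0// mulr_gt0 // lt_max expR_gt0.
Qed.

Let den_gt0 (t s : R) : 0 < expR (- ((s + t) / 2)) * D.
Proof. by rewrite mulr_gt0// expR_gt0. Qed.

Let cone_distxx p : cone_dist p p = 0.
Proof.
case: p => x t /=; rewrite mdistxx add0r maxxx.
have -> : (t%:num + t%:num) / 2 = t%:num :> R by field.
rewrite divff ?ln1 ?mulr0//.
by rewrite gt_eqF// mulr_gt0// expR_gt0.
Qed.

Let cone_dist_sym p q : cone_dist p q = cone_dist q p.
Proof.
by case: p q => [x t] [y s] /=; rewrite metric_sym maxC [s%:num + _]addrC.
Qed.

Let sqr_half (t s : R) :
  expR (- ((s + t) / 2)) * expR (- ((s + t) / 2)) = expR (- t) * expR (- s).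
Proof. by rewrite -!expRD; congr expR; field. Qed.

Let cone_dist_positivity p q : cone_dist p q = 0 -> p = q.
Proof.
case: p q => [x t] [y s] /= /eqP; rewrite mulf_eq0 pnatr_eq0/=.
rewrite ln_eq0 ?divr_gt0// => /eqP/divr1_eq.
set T := expR (- t%:num); set S := expR (- s%:num).
set E := expR _; set d := mdist x y => eqE.
have T0 : 0 < T by exact: expR_gt0.
have S0 : 0 < S by exact: expR_gt0.
have E0 : 0 < E by exact: expR_gt0.
have EE : E * E = T * S by exact: sqr_half.
have d0 : 0 <= d by exact: mdist_ge0.
have [dz TS] : d = 0 /\ T = S.
  have [le1|le1] := leP T S; rewrite ?(max_r le1) ?(max_l (ltW le1)) in eqE.
    have ES : E <= S.
      by rewrite -(@ler_pXn2r _ 2) ?nnegrE ?(ltW E0, ltW S0, ltW T0)// !expr2 EE ler_pM2r.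
    have ED : E * D <= S * D by rewrite ler_pM2r.
    have dz : d = 0 by lra.
    have {}eqE : S = E by apply: (mulIf (lt0r_neq0 D_gt0)); rewrite -eqE dz add0r.
    split => //; apply: (mulIf (lt0r_neq0 S0)); rewrite -EE -eqE//.
  have ET : E <= T.
    by rewrite -(@ler_pXn2r _ 2) ?nnegrE ?(ltW E0, ltW S0, ltW T0)// !expr2 EE ler_pM2l// ltW.
  have ED : E * D <= T * D by rewrite ler_pM2r.
  have dz : d = 0 by lra.
  have {}eqE : T = E by apply: (mulIf (lt0r_neq0 D_gt0)); rewrite -eqE dz add0r.
  by split => //; apply: (mulfI (lt0r_neq0 T0)); rewrite -EE -eqE.
have -> : x = y by exact: mdist_positivity.
congr pair; apply/val_inj => /=.
by apply: oppr_inj; apply: expR_inj.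
Qed.

Let cone_dist_triangle q p r : cone_dist p r <= cone_dist p q + cone_dist q r.
Proof.
case: p q r => [x t] [y s] [z u] /=.
rewrite -mulrDr ler_pM2l// -lnM ?posrE ?divr_gt0//.
rewrite ler_ln ?posrE ?mulr_gt0 ?divr_gt0 ?invr_gt0//.
rewrite mulf_div ler_pdivrMr// mulrAC ler_pdivlMr ?mulr_gt0//.
set T := expR (- t%:num); set S := expR (- s%:num); set U := expR (- u%:num).
set E1 := expR (- ((s%:num + t%:num) / 2)).
set E2 := expR (- ((u%:num + s%:num) / 2)).
set E3 := expR (- ((u%:num + t%:num) / 2)).
have -> : E1 * D * (E2 * D) = (S * D) * (E3 * D).
  suff E : E1 * E2 = S * E3 by rewrite mulrACA E; ring.
  by rewrite /E1 /E2 /S /E3 -!expRD; congr expR; field.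
rewrite [leLHS]mulrA (ler_pM2r (mulr_gt0 (expR_gt0 _) D_gt0)).
have T0 : 0 < T by exact: expR_gt0.
have S0 : 0 < S by exact: expR_gt0.
have U0 : 0 < U by exact: expR_gt0.
have dxz := metric_triangle x y z.
have dxy0 := mdist_ge0 x y; have dyz0 := mdist_ge0 y z.
set a := mdist x z in dxz *; set b := mdist x y in dxz dxy0 *.
set c := mdist y z in dxz dyz0 *.
set mTU := Num.max T U; set mTS := Num.max T S; set mSU := Num.max S U.
have m1 : S <= mTS by rewrite le_max lexx orbT.
have m2 : S <= mSU by rewrite le_max lexx.
have m3 : mTU * S <= mTS * mSU.
  rewrite /mTU; case: (leP T U) => _.
    rewrite mulrC; apply: ler_pM => //; try exact: ltW.
    by rewrite le_max lexx orbT.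
  apply: ler_pM => //; try exact: ltW.
  by rewrite le_max lexx.
have D0 := D_gt0.
have -> : (b + mTS * D) * (c + mSU * D) =
  b * c + b * (mSU * D) + c * (mTS * D) + mTS * mSU * (D * D) by ring.
have -> : (a + mTU * D) * (S * D) = a * (S * D) + mTU * S * (D * D) by ring.
have h0 : 0 <= b * c by exact: mulr_ge0.
have SD0 : 0 < S * D by exact: mulr_gt0.
have h1 : b * (S * D) <= b * (mSU * D) by rewrite ler_wpM2l// ler_pM2r.
have h2 : c * (S * D) <= c * (mTS * D) by rewrite ler_wpM2l// ler_pM2r.
have h3 : mTU * S * (D * D) <= mTS * mSU * (D * D)
  by rewrite ler_pM2r// mulr_gt0.
have h4 : a * (S * D) <= (b + c) * (S * D) by rewrite ler_pM2r.
rewrite mulrDl in h4; lra.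
Qed.

HB.instance Definition _ := @isMetric.Build R H cone_dist
  cone_distxx cone_dist_positivity cone_dist_sym cone_dist_triangle.

Lemma hyperbolic_cone_mdistE (p q : H) : mdist p q = cone_dist p q.
Proof. by []. Qed.

End HyperbolicCone.

(* Main.v *)
(** A coarsely connected component with two points is uniformly perfect at small
    scales, so there is [delta > 0] such that around every point of [Z] each
    annulus [r / 2 <= d <= r] with [r < delta] is nonempty. Put on the levels
    [n L] ([n >= 1]) of the cone maximal [s_n]-separated subsets [A_n] of [Z],
    where [s_n = D exp (k - n L)]. For [k] large the union [G] of these levels is
    so sparse that coarse properness makes it uniformly locally finite; for [L]
    large every [x] in [A_n] has two points of [A_{n+1}] at distance less than
    [s_n / 2], one near [x] and one near a point of an annulus around [x].
    Separation of [A_n] makes the children of distinct points distinct, so [G]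
    carries two injections with disjoint images at bounded distance from the
    identity, and every finite [F] satisfies [#F <= #(boundary F)]. *)

Require Import Defs.
From mathcomp Require Import all_boot all_order all_algebra finmap.
From mathcomp Require Import all_classical all_reals.
From mathcomp Require Import ereal topology normedtype sequences exp.
From mathcomp Require Import zify ring lra.

Set Implicit Arguments.
Unset Strict Implicit.
Unset Printing Implicit Defensive.

Import Order.TTheory GRing.Theory Num.Theory.

Local Open Scope classical_set_scope.
Local Open Scope ring_scope.

(** * Separated sets and doubling maps in metric spaces *)

Section MetricSpaces.
Context {R : realType}.
Implicit Type X : metricType R.

Definition separated X (s : R) (A : set X) : Prop :=
  forall x y : X, A x -> A y -> x <> y -> s <= mdist x y.

(** By Zorn: a point at distance at least [s] from all of a maximal separated set could be added to
    it. *)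
Lemma maximal_separated X (s : R) : 0 < s ->
  exists A : set X, separated s A /\
    forall z : X, exists2 a, A a & mdist z a < s.
Proof.
move=> s0; pose P := [set A : set X | separated s A].
have /Zorn_bigcup[A [sepA maxA]] : forall F : set (set X), F `<=` P ->
    total_on F subset -> P (\bigcup_(B in F) B).
  move=> F FP totF x y [B FB Bx] [C FC Cy].
  by have [BC|CB] := totF _ _ FB FC;
    [apply: (FP _ FC) => //; exact: BC|apply: (FP _ FB) => //; exact: CB].
exists A; split => // z; apply: contrapT => noa.
have far a : A a -> s <= mdist z a.
  by move=> Aa; rewrite leNgt; apply/negP => za; apply: noa; exists a.
apply: (maxA (z |` A)).
  split; first by move=> a Aa; right.
  move=> /(_ z (or_introl erefl)) Az.
  by have := far _ Az; rewrite mdistxx leNgt s0.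
move=> x y [->|Ax] [->|Ay] xy; [by []|exact: far|rewrite metric_sym; exact: far|].
exact: sepA.
Qed.

Lemma dist_set_lt X (x y : X) (A : set X) (r : R) :
  A y -> mdist x y < r -> (dist_set x A < r%:E)%E.
Proof.
move=> Ay xy; apply: (@le_lt_trans _ _ (mdist x y)%:E); last by rewrite lte_fin.
by apply: ereal_inf_lbound; exists y.
Qed.

(** Two points in one ball of radius [k] are less than [2 * k] apart, so each ball of a cover holds
    at most one point of [G] and the number of balls bounds the count. *)
Lemma separated_uniformly_locally_finite X : uniformly_coarsely_proper X ->
  exists2 k : R, 0 < k &
    forall G : set X, separated (2 * k) G -> uniformly_locally_finite G.
Proof.
move=> [N [rb [rb0 covN]]]; exists (rb + 1); first by lra.
set k := rb + 1 => G sepG.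
exists (fun r => N (r + k + 1) k) => r x r0.
have [||c cov] := covN (r + k + 1) k _ _ x; [rewrite /k; lra|lra|].
set n := N _ _ in c cov *.
(* Indices from [n] on, and those whose ball misses [G], get the dummy value [x]. *)
have uniq (i : nat) : exists y : X, forall z, G z ->
    (exists2 j : 'I_n, j = i :> nat & ball (c j) k z) -> z = y.
  have [[y [Gy [j ji yj]]]|no] := pselect (exists y, G y /\
      exists2 j : 'I_n, j = i :> nat & ball (c j) k y); last first.
    by exists x => z Gz hz; exfalso; apply: no; exists z.
  exists y => z Gz [j' j'i zj']; apply: contrapT => zy.
  have jj' : j' = j by apply: val_inj; rewrite /= j'i ji.
  have := sepG _ _ Gz Gy zy; move: zj' yj; rewrite jj' !ballEmdist /= => h1 h2.
  have := metric_triangle z (c j) y; rewrite (metric_sym z (c j)); lra.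
have [g Hg] := choice uniq.
apply: (@card_le_trans _ _ _ (g @` `I_n)); last exact: card_image_le.
apply: subset_card_le => z [Gz xz].
have [|j _ zj] := cov z; first by move: xz; rewrite !ballEmdist /= /k; lra.
by exists (j : nat) => /=; [exact: ltn_ord|apply/esym; apply: Hg => //; exists j].
Qed.

(* The points of [f F] and [g F] outside [F] all lie in the boundary of [F], *)
(* and there are at least [2 #F - #F] of them.                               *)
Lemma doubling_non_amenable X (G : set X) (r : R) (f g : X -> X) :
  quasi_lattice G -> 0 < r ->
  (forall x, G x -> G (f x) /\ G (g x)) ->
  (forall x, G x -> mdist x (f x) < r /\ mdist x (g x) < r) ->
  (forall x y, G x -> G y -> f x = f y -> x = y) ->
  (forall x y, G x -> G y -> g x = g y -> x = y) ->
  (forall x y, G x -> G y -> f x <> g y) ->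
  non_amenable X.
Proof.
move=> qG r0 Gfg dfg finj ginj fg; exists G; split => //.
exists 1, r; split => // F finF FG; rewrite mul1r ler_nat.
have finB := finite_boundary qG.2 r0 finF.
pose K := fset_set F.
have KF x : x \in K -> F x by rewrite /K in_fset_set // inE.
have FK x : F x -> x \in K by rewrite /K in_fset_set // inE.
pose U := ((f @` K) `|` (g @` K))%fset.
have cardU : #|` U| = (#|` K| + #|` K|)%N.
  have cf : #|` (f @` K)%fset| = #|` K|.
    by apply: card_in_imfset => x y /KF/FG Gx /KF/FG Gy; exact: finj.
  have cg : #|` (g @` K)%fset| = #|` K|.
    by apply: card_in_imfset => x y /KF/FG Gx /KF/FG Gy; exact: ginj.
  rewrite /U cardfsU cf cg.
  suff -> : ((f @` K) `&` (g @` K) = fset0)%fset by rewrite cardfs0 subn0.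
  apply/fsetP => z; rewrite !inE; apply/negP => /andP[].
  move=> /imfsetP[x /= /KF/FG Gx ->] /imfsetP[y /= /KF/FG Gy].
  exact: fg.
have UB : (U `\` K `<=` fset_set (boundary G r F))%fset.
  have near x z : F x -> G z -> mdist x z < r -> z \notin K -> boundary G r F z.
    move=> Fx Gz xz zK; split => //.
      by apply: (dist_set_lt Fx); rewrite metric_sym.
    apply: (@dist_set_lt _ _ z); last by rewrite mdistxx.
    by split => // /FK; exact/negP.
  apply/fsubsetP => z; rewrite in_fset_set // !inE => /andP[zK].
  by case/orP => /imfsetP[x /= /KF Fx ez]; apply: (near x) => //;
    rewrite ez; have [? ?] := Gfg _ (FG _ Fx); have [? ?] := dfg _ (FG _ Fx).
have := fsubset_leq_card UB; have := cardfsID K U.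
have := fsubset_leq_card (fsubsetIr U K); rewrite -/K cardU; lia.
Qed.

(** * Uniform perfectness of components *)

Definition uniformly_perfect_below X (delta : R) (A : set X) : Prop :=
  forall (z : X) (r : R), A z -> 0 < r -> r < delta ->
    exists w : X, r / 2 <= mdist z w /\ mdist z w <= r.

(** Along a path with steps at most [r / 2], the last vertex before the first exit from the closed
    ball of radius [r] lies in the annulus. *)
Lemma coarse_path_crossing X (A : set X) (z a b : X) (r : R) :
  uniformly_coarsely_connected A -> A a -> A b -> 0 < r ->
  mdist z a <= r -> r < mdist z b ->
  exists w : X, r / 2 <= mdist z w /\ mdist z w <= r.
Proof.
move=> uA Aa Ab r0 za zb.
have r20 : 0 < r / 2 by lra.
have [n [u [u0 un _ step]]] := uA _ r20 _ _ Aa Ab.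
have exP : exists i, r < mdist z (u i) by exists n; rewrite un.
have /= := ex_minnP exP; case=> -[|i] ri mini.
  by move: ri; rewrite u0 ltNge za.
have lein : (i < n)%N by apply: mini; rewrite un.
have zi : mdist z (u i) <= r.
  by rewrite leNgt; apply/negP => /mini; rewrite ltnn.
exists (u i); split => //.
have := step _ lein; have := metric_triangle z (u i) (u i.+1); lra.
Qed.

(** For [r] below [mdist a b / 2], the points [a] and [b] are not both within [r] of [z]. So a path
    leaves the ball either from [z] to [x0] or from [x0] to one of them, inside a single one of the
    sets whose union is the component. *)
Lemma ucc_component_perfect X (C : set X) : ucc_component C -> two_points C ->
  exists2 delta : R, 0 < delta & uniformly_perfect_below delta C.
Proof.
move=> [x0 ->] [a [b [Ca Cb /eqP ab]]].
have ab0 : 0 < mdist a b by rewrite mdist_gt0.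
exists (mdist a b / 2); first by lra.
move=> z r [A [Ax0 uA] Az] r0 rd.
have [rz|zr] := ltP r (mdist z x0).
  by apply: (coarse_path_crossing uA Az Ax0) => //; rewrite mdistxx ltW.
have [c [B [Bx0 uB] Bc] zc] : exists2 c, ucc_component_of x0 c & r < mdist z c.
  have [rza|zar] := ltP r (mdist z a); first by exists a.
  exists b => //; have := metric_triangle a z b; rewrite (metric_sym a z); lra.
exact: (coarse_path_crossing uB Bx0 Bc).
Qed.

(** Finiteness keeps the minimum of the scales of the components positive. *)
Lemma finite_union_perfect X (P : set (set X)) : finite_set P ->
  (forall C, P C -> ucc_component C /\ two_points C) ->
  exists2 delta : R, 0 < delta &
    uniformly_perfect_below delta (\bigcup_(C in P) C).
Proof.
move=> /finite_seqP[s ->]; elim: s => [|C s IHs] PC.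
  by exists 1 => // z r [].
have [|d d0 Hd] := IHs; first by move=> B Bs; apply: PC; rewrite /= inE Bs orbT.
have [|uC tC] := PC C; first by rewrite /= inE eqxx.
have [e e0 He] := ucc_component_perfect uC tC.
exists (Num.min d e); first by rewrite lt_min d0.
move=> z r [B + Bz] r0; rewrite lt_min /= inE => /orP[/eqP BC|Bs] /andP[rd re].
  by apply: He => //; rewrite -BC.
by apply: Hd => //; exists B.
Qed.

End MetricSpaces.

(** * Estimates for the cone metric *)

Section Cone.
Context {R : realType} {Z : metricType R}.
Variables (Zb : bounded_space Z) (Z2 : two_points [set: Z]).
Local Notation H := (hyperbolic_cone Zb Z2).
Local Notation D := (diam Z).

Lemma diam_gt0 : 0 < D.
Proof.
have [x [y [_ _ /eqP xy]]] := Z2; have [M HM] := Zb.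
apply: (@lt_le_trans _ _ (mdist x y)); first by rewrite mdist_gt0.
by apply: ub_le_sup; [exists M => _ [a [b ->]]|exists x, y].
Qed.

(** The formula for the metric solved for its numerator, so that bounds on distances become
    comparisons of exponentials. *)
Lemma cone_num_expE (p q : H) :
  mdist p.1 q.1 + Num.max (expR (- p.2%:num)) (expR (- q.2%:num)) * D =
  expR (mdist p q / 2 - (q.2%:num + p.2%:num) / 2) * D.
Proof.
rewrite hyperbolic_cone_mdistE; case: p q => [x t] [y s] /=.
have num0 : 0 < mdist x y + Num.max (expR (- t%:num)) (expR (- s%:num)) * D.
  by rewrite ltr_wpDl ?mdist_ge0// mulr_gt0 ?diam_gt0// lt_max expR_gt0.
have den0 : 0 < expR (- ((s%:num + t%:num) / 2)) * D.
  by rewrite mulr_gt0 ?expR_gt0 ?diam_gt0.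
rewrite mulrAC divff ?pnatr_eq0// mul1r expRD lnK ?posrE ?divr_gt0//.
by rewrite -mulrA divfK// gt_eqF.
Qed.

Lemma cone_dist_ge_height (p q : H) : q.2%:num - p.2%:num <= mdist p q.
Proof.
have := cone_num_expE p q; have D0 := diam_gt0.
have : expR (- p.2%:num) * D <=
    Num.max (expR (- p.2%:num)) (expR (- q.2%:num)) * D.
  by rewrite ler_pM2r// le_max lexx.
have := mdist_ge0 p.1 q.1 => h1 h2 h3.
have : expR (- p.2%:num) * D <= expR (mdist p q / 2 - (q.2%:num + p.2%:num) / 2) * D.
  by lra.
rewrite ler_pM2r// ler_expR; lra.
Qed.

(** At a common height [t] the numerator is [D * expR (mdist p q / 2 - t)]; this dictates the
    separation [s n] of the levels. *)
Lemma cone_dist_ge_level (p q : H) (k : R) : p.2 = q.2 ->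
  D * expR (k - p.2%:num) <= mdist p.1 q.1 -> 2 * k <= mdist p q.
Proof.
have := cone_num_expE p q; have D0 := diam_gt0 => + pq.
rewrite -pq maxxx => h1 h2.
have h3 : 0 < expR (- p.2%:num) * D by rewrite mulr_gt0 ?expR_gt0.
have : expR (k - p.2%:num) * D <= expR (mdist p q / 2 - (p.2%:num + p.2%:num) / 2) * D.
  by rewrite [_ * D]mulrC; lra.
rewrite ler_pM2r// ler_expR; lra.
Qed.

(** Both terms of the numerator are at most [D * expR (k - p.2%:num)]. Absorbing the factor 2 into
    [expR 1] costs [2] in the distance, and the height difference costs at most [L]. *)
Lemma cone_dist_le (p q : H) (k L : R) : 0 <= k -> p.2%:num <= q.2%:num ->
  q.2%:num <= p.2%:num + L -> mdist p.1 q.1 <= D * expR (k - p.2%:num) ->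
  mdist p q <= 2 * k + 2 + L.
Proof.
have := cone_num_expE p q; have D0 := diam_gt0 => + k0 pq qpL dpq.
rewrite max_l ?ler_expR ?lerN2// => h1.
have e2 : expR (- p.2%:num) * D <= expR (k - p.2%:num) * D.
  by rewrite ler_pM2r// ler_expR; lra.
have e3 : 2 * expR (k - p.2%:num) * D <= expR (1 + k - p.2%:num) * D.
  rewrite ler_pM2r// -addrA (expRD 1) ler_pM2r ?expR_gt0//.
  by have := expR_ge1Dx (1 : R); lra.
have : expR (mdist p q / 2 - (q.2%:num + p.2%:num) / 2) * D <=
    expR (1 + k - p.2%:num) * D.
  by rewrite -h1; move: e3 dpq; rewrite -mulrA mulrC [D * _]mulrC; lra.
rewrite ler_pM2r// ler_expR; lra.
Qed.

End Cone.

(** * The net of levels and its doubling maps *)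

Theorem theoremA (R : realType) (Z : metricType R)
  (Zb : bounded_space Z) (Z2 : two_points [set: Z])
  (Hproper : uniformly_coarsely_proper (hyperbolic_cone Zb Z2))
  (Zcomp : exists P : set (set Z),
     [/\ finite_set P,
         forall C : set Z, P C -> ucc_component C /\ two_points C
       & \bigcup_(C in P) C = [set: Z]]) :
  non_amenable (hyperbolic_cone Zb Z2).
Proof.
have [k k0 sepulf] := separated_uniformly_locally_finite Hproper.
have [P [finP PC covP]] := Zcomp.
have [delta delta0] := finite_union_perfect finP PC.
rewrite covP => perfZ; set D := diam Z.
have D0 : 0 < D := diam_gt0 Zb Z2.
(* [L] meets three demands through [1 + L <= expR L]: levels at least [2 * k] apart,
   [s n.+1 <= s n / 32], and, by the summand [M], every [s n] below [delta]. *)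
pose M := D * expR k / delta.
have M0 : 0 < M by rewrite divr_gt0 // mulr_gt0 ?expR_gt0.
pose L := 2 * k + 32 + M.
have L0 : 0 < L by rewrite /L; lra.
have kL : 2 * k <= L by rewrite /L; lra.
have expL : 1 + L <= expR L := expR_ge1Dx L.
(* The level indexed by [n] has height [n.+1 L]: height [0] is too coarse. *)
pose s n : R := D * expR (k - n.+1%:R * L).
have s0 n : 0 < s n by rewrite mulr_gt0 ?expR_gt0.
have sS n : s n.+1 <= s n / 32.
  have -> : s n.+1 = s n * expR (- L).
    by rewrite /s -mulrA -expRD -[n.+2%:R]natr1; congr (_ * expR _); ring.
  rewrite ler_pM2l // expRN lef_pV2 ?posrE ?expR_gt0 //.
  by move: expL; rewrite /L; lra.
have s_delta n : s n < delta.
  apply: (@le_lt_trans _ _ (D * expR k / expR L)).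
    rewrite -mulrA -expRN -expRD ler_pM2l // ler_expR lerD2l lerN2.
    by rewrite ler_peMl ?ler1n // ltW.
  rewrite ltr_pdivrMr ?expR_gt0 // [ltRHS]mulrC -ltr_pdivrMr // -/M.
  by move: expL; rewrite /L; lra.
have [A HA] := choice (fun n => maximal_separated Z (s0 n)).
pose G := [set p : hyperbolic_cone Zb Z2 |
  exists2 n, p.2%:num = n.+1%:R * L & A n p.1].
have lift n z : A n z -> exists2 p, G p & p.1 = z /\ p.2%:num = n.+1%:R * L.
  move=> Az; have h : 0 <= n.+1%:R * L by rewrite mulr_ge0 // ltW.
  by exists (z, NngNum h) => //; exists n.
have heightI n m : n.+1%:R * L = m.+1%:R * L -> n = m.
  by move/(mulIf (lt0r_neq0 L0))/eqP; rewrite eqr_nat eqSS => /eqP.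
have qG : quasi_lattice G.
  split; last first.
    (* Distinct levels are separated by their heights, points of one level by the separation of
       [A n]. *)
    apply: sepulf => p q [n pn Ap] [m qm Aq] pq.
    have far (p' q' : hyperbolic_cone Zb Z2) n' m' : p'.2%:num = n'.+1%:R * L ->
        q'.2%:num = m'.+1%:R * L -> (n' < m')%N -> 2 * k <= mdist p' q'.
      move=> pn' qm' nm; apply: le_trans (cone_dist_ge_height p' q').
      have : n'.+2%:R * L <= m'.+1%:R * L by rewrite ler_pM2r // ler_nat.
      rewrite pn' qm' -[n'.+2%:R]natr1 mulrDl mul1r; lra.
    have [nm|mn|nm] := ltngtP n m; first exact: far pn qm nm.
      by rewrite metric_sym; exact: far qm pn mn.
    have pq2 : p.2 = q.2 by apply: val_inj; rewrite /= pn qm nm.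
    apply: cone_dist_ge_level => //; rewrite pn.
    apply: (HA n).1 => //; first by rewrite nm.
    by move=> pq1; apply: pq; case: p q pq1 pq2 {pn Ap qm Aq} => ? ? [? ?] /= -> ->.
  exists (2 * k + 2 + L + 1); split; first by lra.
  (* Rounding the height up: level [n] lies above [p] by at most [L], so [s n] is at most
     [D * expR (k - p.2%:num)]. *)
  move=> p; pose n := Num.trunc (p.2%:num / L).
  have p0 : 0 <= p.2%:num by [].
  have pL0 : 0 <= p.2%:num / L by rewrite divr_ge0 // ltW.
  have /andP[] := truncn_itv pL0; rewrite -/n ler_pdivlMr // ltr_pdivrMr // => np pn.
  have [a Aa pa] := (HA n).2 p.1.
  have [q Gq [qa qn]] := lift _ _ Aa.
  apply: (dist_set_lt Gq).
  suff : mdist p q <= 2 * k + 2 + L by lra.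
  apply: cone_dist_le; rewrite ?qn ?qa //; try exact: ltW.
    by rewrite -natr1 mulrDl mul1r lerD2r.
  by apply: (le_trans (ltW pa)); rewrite ler_pM2l // ler_expR lerD2l lerN2 ltW.
(* For [p] on level [n] the bound is [s n / 2]: parents of a common child are less than [s n] apart
   on the same level, hence equal. *)
pose child (p q : hyperbolic_cone Zb Z2) := [/\ G q, q.2%:num = p.2%:num + L
  & mdist p.1 q.1 < D * expR (k - p.2%:num) / 2].
have child_inj p p' q : G p -> G p' -> child p q -> child p' q -> p = p'.
  move=> [n pn Ap] [m pm Ap'] [_ qp dpq] [_ qp' dpq'].
  have pp2 : p.2%:num = p'.2%:num by lra.
  have nm : n = m by apply: heightI; rewrite -pn -pm.
  have pp1 : p.1 = p'.1.
    apply: contrapT => /((HA n).1 _ _ Ap); rewrite nm => /(_ Ap').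
    have := metric_triangle p.1 q.1 p'.1; rewrite (metric_sym q.1).
    move: dpq dpq'; rewrite -pp2 pn nm -/(s m); lra.
  move/val_inj: pp2; case: p p' pp1 {pn Ap pm Ap' qp dpq qp' dpq'} => ? ? [? ?] /=.
  by move=> -> ->.
have ex_children p : exists q : hyperbolic_cone Zb Z2 * hyperbolic_cone Zb Z2,
    G p -> [/\ child p q.1, child p q.2 & q.1 <> q.2].
  have [[n pn Ap]|nGp] := pselect (G p); last by exists (p, p).
  have sn := s0 n; have sd := s_delta n; have ss := sS n.
  (* Here [w] is between [s n / 8] and [s n / 4] away from [p.1], while [y] and [v] are within
     [s n / 32] of [p.1] and [w]. So [v] is within [s n / 2] of [p.1], and [y = v] would put [w]
     within [s n / 16] of it. *)
  have [|||w [pw wp]] := perfZ p.1 (s n / 4) => //; try lra.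
  have [y Ay py] := (HA n.+1).2 p.1; have [v Av wv] := (HA n.+1).2 w.
  have [q1 G1 [q1y q1n]] := lift _ _ Ay; have [q2 G2 [q2v q2n]] := lift _ _ Av.
  have height : n.+2%:R * L = p.2%:num + L by rewrite pn -natr1 mulrDl mul1r.
  exists (q1, q2) => _; split => /=.
  - by split => //; [rewrite q1n|rewrite pn -/(s n) q1y; lra].
  - split => //; [by rewrite q2n|rewrite pn -/(s n) q2v].
    by have := metric_triangle p.1 w v; lra.
  - move=> q12; have yv : y = v by rewrite -q1y -q2v q12.
    have := metric_triangle p.1 y w; rewrite (metric_sym y) yv.
    by move: py; rewrite yv; lra.
have [fg Hfg] := choice ex_children.
have child_near p q : child p q -> mdist p q < 2 * k + 2 + L + 1.
  move=> [_ qp pq]; have e0 : 0 < D * expR (k - p.2%:num).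
    by rewrite mulr_gt0 ?expR_gt0.
  suff : mdist p q <= 2 * k + 2 + L by lra.
  by apply: cone_dist_le; rewrite -/D ?qp; lra.
apply: (@doubling_non_amenable _ _ G (2 * k + 2 + L + 1)
  (fun p => (fg p).1) (fun p => (fg p).2)) => //; first by lra.
- by move=> p /Hfg[[? ? ?] [? ? ?] _].
- by move=> p /Hfg[? ? _]; split; exact: child_near.
- move=> p q Gp Gq e; have [cp _ _] := Hfg _ Gp; have [cq _ _] := Hfg _ Gq.
  by apply: child_inj cp _ => //; rewrite e.
- move=> p q Gp Gq e; have [_ cp _] := Hfg _ Gp; have [_ cq _] := Hfg _ Gq.
  by apply: child_inj cp _ => //; rewrite e.
- move=> p q Gp Gq e; have [cp _ +] := Hfg _ Gp; have [_ cq _] := Hfg _ Gq.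
  (* A common value would have a single parent, whose two children differ. *)
  have pq : p = q by apply: child_inj cp _ => //; rewrite e.
  by move: e; rewrite -pq.
Qed.
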